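(* Let $R$ be a maximal non valuative domain. If $R$ is integrally closed (in its quotient field), then the following statements hold: (i) $2\leq |\mathrm{Max}(R)|\leq 4$. (ii) If $|\mathrm{Max}(R)| = 2$, then there are exactly two non-maximal prime ideals of $R$ that are not comparable, i.e. there is exactly one unordered pair $\{P,Q\}$ of non-maximal prime ideals of $R$ with $P\not\subseteq Q$ and $Q\not\subseteq P$. Otherwise, the set of non-maximal prime ideals of $R$ is linearly ordered by inclusion. (iii) There are at most two maximal ideals of $R$ that do not contain all non-maximal prime ideals of $R$.
   Context: All rings are commutative with identity and are integral domains; $\mathrm{qf}(R)$ denotes the quotient field of $R$, and $\mathrm{Max}(R)$ the set of maximal ideals of $R$. An overring of $R$ is a subring of $\mathrm{qf}(R)$ containing $R$. An integral domain $R$ is a valuative domain if for each nonzero $x\in \mathrm{qf}(R)$, at least one of the extensions $R\subseteq R[x]$ and $R\subseteq R[x^{-1}]$ has no ring strictly between its two ends (equality of the two ends is allowed). An integral domain $R$ is a maximal non valuative domain if $R$ is not a valuative domain but every overring of $R$ properly containing $R$ is a valuative domain. *)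

(* Defs.v *)
From HB Require Import structures.
From mathcomp Require Import all_boot all_order all_algebra.
From mathcomp Require Import all_classical.

Set Implicit Arguments.
Unset Strict Implicit.
Unset Printing Implicit Defensive.

Import GRing.Theory.

Local Open Scope classical_set_scope.
Local Open Scope card_scope.
Local Open Scope ring_scope.

(* A domain and its overrings live in one field: an overring of [R] is a
   subring of [{fraction R}] containing the image of [R]. Hence valuativity
   is defined for subrings [A] of a field [K]; [A] need not generate [K]. *)
Section Subrings.
Variable K : fieldType.
Implicit Types (A B C : set K) (x : K).

Definition is_subring A : Prop := subring_closed (mem A).

Definition quotient_field A : set K :=
  [set a / b | a in A & b in A `\ 0].

Definition adjoin A x : set K := smallest is_subring (A `|` [set x]).

Definition no_strictly_between A B : Prop :=
  forall C, is_subring C -> A `<=` C -> C `<=` B -> C = A \/ C = B.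

Definition valuative A : Prop :=
  forall x, quotient_field A x -> x != 0 ->
    no_strictly_between A (adjoin A x) \/ no_strictly_between A (adjoin A x^-1).

End Subrings.

Section Domains.
Variable R : idomainType.
Implicit Types I J P Q : set R.

Definition base_ring : set {fraction R} := range (@tofrac R).

Definition is_overring (S : set {fraction R}) : Prop :=
  is_subring S /\ base_ring `<=` S.

Definition valuative_domain : Prop := valuative base_ring.

Definition maximal_non_valuative_domain : Prop :=
  ~ valuative_domain /\
  forall S, is_overring S -> base_ring `<` S -> valuative S.

Definition integrally_closed_domain : Prop :=
  forall x : {fraction R}, integralOver (@tofrac R) x -> base_ring x.

(* [idealr_closed] requires [1 \notin I]. *)
Definition is_proper_ideal I : Prop := idealr_closed (mem I).

Definition is_prime_ideal P : Prop :=
  is_proper_ideal P /\ prime_idealr_closed (mem P).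

Definition is_maximal_ideal I : Prop :=
  is_proper_ideal I /\ forall J, is_proper_ideal J -> I `<=` J -> J = I.

Definition Max : set (set R) := [set I | is_maximal_ideal I].

Definition non_maximal_primes : set (set R) :=
  [set P | is_prime_ideal P /\ ~ is_maximal_ideal P].

Definition incl_comparable P Q : Prop := P `<=` Q \/ Q `<=` P.

End Domains.

Arguments Max R : clear implicits.
Arguments non_maximal_primes R : clear implicits.
Arguments base_ring R : clear implicits.

(* Main.v *)
(* Let [p = m p'] and [q = n q'] be comaximal elements of a domain [A], with
   [m], [n] nonunits, such that no power of [m] (resp. [n]) is divisible by [p]
   (resp. [q]). Then [A[q / m]] lies strictly between [A] and [A[q / p]], and
   symmetrically for [p / q], so [A] is not valuative. Such [m], [p] exist when
   two maximal ideals each contain one of the factors of [p = m p'], and also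
   when [p] lies in [P1] and [m] in [P2] outside [P1], for primes [P1 < P2] of a
   valuation ring. Two such pairs located at some primes of [R], together with a
   maximal ideal contained in none of these, give a proper overring of [R] (an
   intersection of localizations) that is not valuative. This excludes five
   maximal ideals and the configurations of primes forbidden by (ii) and (iii).
   [R] is not local, for otherwise some [R[x]] would map onto a polynomial ring
   over the residue field; so each localization at a maximal ideal is a proper
   overring, hence valuative, hence a valuation ring. Finally, if [R] has two
   maximal ideals and all non-maximal primes lie in one of them, then [R] is
   valuative. *)

Require Import Defs.
From mathcomp Require Import all_boot all_order all_algebra.
From mathcomp Require Import all_classical.
From mathcomp Require Import ring.

Set Implicit Arguments.
Unset Strict Implicit.
Unset Printing Implicit Defensive.

Import GRing.Theory.

Local Open Scope classical_set_scope.
Local Open Scope card_scope.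
Local Open Scope ring_scope.

(** * Subrings of a field, adjunction of one element, and arms *)

Section SubringTheory.
Variable K : fieldType.
Implicit Types (A B C : set K) (x y : K).

Lemma is_subringP A :
  is_subring A <->
  [/\ A 1, forall x y, A x -> A y -> A (x - y)
    & forall x y, A x -> A y -> A (x * y)].
Proof.
split=> [[A1 AB AM]|[A1 AB AM]]; split.
- exact/set_mem.
- by move=> x y Ax Ay; apply/set_mem/AB; exact/mem_set.
- by move=> x y Ax Ay; apply/set_mem/AM; exact/mem_set.
- exact/mem_set.
- by move=> x y /set_mem Ax /set_mem Ay; apply/mem_set/AB.
- by move=> x y /set_mem Ax /set_mem Ay; apply/mem_set/AM.
Qed.

Section Closure.
Variable A : set K.
Hypothesis sA : is_subring A.

Lemma subring1 : A 1. Proof. by case/is_subringP: sA. Qed.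

Lemma subringB x y : A x -> A y -> A (x - y).
Proof. by case/is_subringP: sA => _ + _; apply. Qed.

Lemma subringM x y : A x -> A y -> A (x * y).
Proof. by case/is_subringP: sA => _ _; apply. Qed.

Lemma subring0 : A 0.
Proof. by rewrite -(subrr 1); apply: subringB; exact: subring1. Qed.

Lemma subringN x : A x -> A (- x).
Proof. by move=> Ax; rewrite -sub0r; apply: subringB => //; exact: subring0. Qed.

Lemma subringD x y : A x -> A y -> A (x + y).
Proof. by move=> Ax Ay; rewrite -(opprK y); apply/subringB/subringN. Qed.

Lemma subringX x n : A x -> A (x ^+ n).
Proof.
by move=> Ax; elim: n => [|n IHn]; [exact: subring1|rewrite exprS; exact: subringM].
Qed.

End Closure.

Lemma is_subring_bigcap (I : Type) (D : set I) (F : I -> set K) :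
  (forall i, D i -> is_subring (F i)) -> is_subring (\bigcap_(i in D) F i).
Proof.
move=> sF; apply/is_subringP; split=> [i Di|x y Fx Fy i Di|x y Fx Fy i Di].
- exact: (subring1 (sF i Di)).
- by apply: (subringB (sF i Di)); [exact: Fx|exact: Fy].
- by apply: (subringM (sF i Di)); [exact: Fx|exact: Fy].
Qed.

Lemma adjoin_subring A x : is_subring (adjoin A x).
Proof. by apply: is_subring_bigcap => B []. Qed.

Lemma sub_adjoin A x : A `<=` adjoin A x.
Proof. by move=> y Ay B [_]; apply; left. Qed.

Lemma mem_adjoin A x : adjoin A x x.
Proof. by move=> B [_]; apply; right. Qed.

Lemma adjoin_min A B x : is_subring B -> A `<=` B -> B x -> adjoin A x `<=` B.
Proof. by move=> sB AB Bx y; apply; split=> // z [/AB//|->]. Qed.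

Lemma adjoin_id A x : is_subring A -> A x -> adjoin A x = A.
Proof.
by move=> sA Ax; apply/seteqP; split; [exact: adjoin_min|exact: sub_adjoin].
Qed.

Lemma no_strictly_between_refl A : no_strictly_between A A.
Proof. by move=> C _ AC CA; left; apply/seteqP. Qed.

(* An arm is what makes [adjoin A (q / p)] non-minimal over [A] as soon as [q]
   is comaximal with [p]: then [adjoin A (q / m)] lies strictly between. *)
Definition arm A (m p : K) : Prop :=
  [/\ A p, A (p / m), ~ A m^-1 & forall k, ~ A (m ^+ k / p)].

Lemma arm_neq0 A m p : is_subring A -> arm A m p -> m != 0 /\ p != 0.
Proof.
move=> sA [Ap Apm mA /(_ 0%N) pA]; split; apply/eqP => z.
- by apply: mA; rewrite z invr0; exact: subring0.
- by apply: pA; rewrite z invr0 mulr0; exact: subring0.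
Qed.

(** [q / m = (q / p) * (p / m)] puts [A[q / m]] inside [A[q / p]]. Multiplied by [m^-1], the
    relation [u * p + v * q = 1] shows that [A[q / m] = A] would invert [m]. Every element of
    [A[q / m]] is carried into [A] by a power of [m]; if [q / p] is such an element, the relation
    multiplied by [m ^+ k / p] puts this quotient in [A]. *)
Lemma arm_strictly_between A m p q u v : is_subring A -> arm A m p ->
  A m -> A q -> A u -> A v -> u * p + v * q = 1 ->
  ~ no_strictly_between A (adjoin A (q / p)).
Proof.
move=> sA armA Am Aq Au Av uv; have [m0 p0] := arm_neq0 sA armA.
case: armA => Ap Apm mA pA /(_ (adjoin A (q / m))).
case.
- exact: adjoin_subring.
- exact: sub_adjoin.
- apply: adjoin_min; [exact: adjoin_subring|exact: sub_adjoin|].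
  have -> : q / m = q / p * (p / m) by field; rewrite m0.
  apply: (subringM (adjoin_subring _ _)); first exact: mem_adjoin.
  exact: sub_adjoin.
- move=> qm; apply: mA.
  have -> : m^-1 = u * (p / m) + v * (q / m) by rewrite -[LHS]mul1r -uv; ring.
  apply: (subringD sA); apply: (subringM sA) => //.
  by rewrite -qm; exact: mem_adjoin.
- move=> eqC.
  suff [k Ak] : exists k, A (m ^+ k * (q / p)).
    apply: (pA k).
    have -> : m ^+ k / p = m ^+ k * u + v * (m ^+ k * (q / p)).
      by rewrite -[LHS]mul1r -uv; field.
    apply: (subringD sA); apply: (subringM sA) => //; exact: subringX.
  have: adjoin A (q / m) `<=` [set z | exists k, A (m ^+ k * z)].
    apply: adjoin_min.
    - apply/is_subringP; split=> [|x y [i Ai] [j Aj]|x y [i Ai] [j Aj]].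
      + by exists 0%N; rewrite mulr1; exact: subring1.
      + exists (i + j)%N.
        rewrite [X in A X](_ : _ = m ^+ j * (m ^+ i * x) - m ^+ i * (m ^+ j * y)).
          by apply: (subringB sA); apply: (subringM sA) => //; exact: subringX.
        by rewrite exprD; ring.
      + exists (i + j)%N.
        rewrite [X in A X](_ : _ = m ^+ i * x * (m ^+ j * y)).
          exact: subringM.
        by rewrite exprD; ring.
    - by move=> z Az; exists 0%N; rewrite mul1r.
    - by exists 1%N; rewrite expr1 mulrCA divff // mulr1.
  by apply; rewrite eqC; exact: mem_adjoin.
Qed.

Lemma two_arms_not_valuative A m p n q u v : is_subring A ->
  arm A m p -> arm A n q -> A m -> A n -> A u -> A v -> u * p + v * q = 1 ->
  ~ valuative A.
Proof.
move=> sA ap aq Am An Au Av uv /(_ (q / p)).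
have [[m0 p0] [n0 q0]] := (arm_neq0 sA ap, arm_neq0 sA aq).
have [[Ap _ _ _] [Aq _ _ _]] := (ap, aq).
case.
- by exists q => //; exists p => //; split=> //; exact/eqP.
- by rewrite mulf_neq0 // invr_eq0.
- exact: (arm_strictly_between sA ap Am Aq Au Av uv).
- rewrite invf_div; apply: (arm_strictly_between sA aq An Ap Av Au).
  by rewrite addrC.
Qed.

(** If [b] divided some [a ^+ k], comaximality would lower the exponent step by step to [0], making
    [b] a unit. *)
Lemma comaximal_arm A a b u v : is_subring A -> A a -> A b -> A u -> A v ->
  u * a + v * b = 1 -> ~ A a^-1 -> ~ A b^-1 -> arm A a (a * b).
Proof.
move=> sA Aa Ab Au Av uv aA bA.
have a0 : a != 0 by apply/eqP => z; apply: aA; rewrite z invr0; exact: subring0.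
have b0 : b != 0 by apply/eqP => z; apply: bA; rewrite z invr0; exact: subring0.
split=> //; first exact: subringM.
  by rewrite mulrC mulKf.
move=> k Ak.
have {Ak}: A (a ^+ k / b).
  have -> : a ^+ k / b = a * (a ^+ k / (a * b)) by field; rewrite ?a0 ?b0.
  exact: subringM.
elim: k => [|k IHk]; first by rewrite mul1r.
move=> Ak; apply: IHk.
have -> : a ^+ k / b = u * (a ^+ k.+1 / b) + v * a ^+ k.
  by rewrite -[LHS]mul1r -uv exprS; field.
apply: (subringD sA); apply: (subringM sA) => //; exact: subringX.
Qed.

End SubringTheory.

Local Open Scope quotient_scope.

Lemma fraction_divP (R : idomainType) (x : {fraction R}) :
  exists a, exists2 b : R, b != 0 & x = tofrac a / tofrac b.
Proof.
elim/quotW: x => r; exists \n_r, \d_r; first exact: denom_ratioP.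
apply/(canRL (mulfK _)); first by rewrite tofrac_eq0 denom_ratioP.
rewrite !piE; apply/eqmodP.
rewrite /= FracField.equivfE /FracField.mulf !numden_Ratio ?oner_eq0 ?mulr1;
  by rewrite ?denom_ratioP // mulrC.
Qed.

Local Close Scope quotient_scope.

(** * Finite cardinality bounds through duplicate-free lists *)

Section Counting.
Variable T : eqType.
Implicit Types (A : set T) (s : seq T).

(* Rewriting with [negb_or] unfolds [==] on the classical [eqType] of sets. *)
Lemma uniq_consP x s :
  uniq (x :: s) <-> (forall y, y \in s -> x <> y) /\ uniq s.
Proof.
split=> [/andP[xs us]|[xs us]]; first by split=> // y ys xy; rewrite xy ys in xs.
by rewrite /= us andbT; apply/negP => /xs.
Qed.

Lemma card_uniq_seq s : uniq s -> [set` s] #= `I_(size s).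
Proof.
elim: s => [|x s IHs] /=; first by rewrite set_nil II0 card_eq0.
case/andP=> xs us; apply/eq_cardSP; exists x; first exact: mem_head.
rewrite (_ : _ `\ x = [set` s]); first exact: IHs.
apply/seteqP; split=> y /=; first by rewrite inE => -[/orP[/eqP|]].
move=> ys; split; first by rewrite inE ys orbT.
by move=> yx; rewrite -yx ys in xs.
Qed.

Lemma card_le_II_seq A n :
  ~ (A #<= `I_n) -> exists s, [/\ uniq s, size s = n.+1 & [set` s] `<=` A].
Proof.
move=> An; suff: forall k, (k <= n.+1)%N ->
    exists s, [/\ uniq s, size s = k & [set` s] `<=` A] by apply.
elim=> [|k IHk] kn; first by exists [::].
have [s [us ss sA]] := IHk (ltnW kn).
have [x Ax xs] : exists2 x, A x & x \notin s.
  apply: contrapT => noX; apply: An.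
  apply: (@card_le_trans _ _ _ [set` s]).
    apply: subset_card_le => x Ax; apply: contrapT => /negP xs.
    by apply: noX; exists x.
  by rewrite (card_le_eql (card_uniq_seq us)) ss card_le_II -ltnS.
exists (x :: s); split; rewrite /= ?xs ?ss //.
by move=> y /=; rewrite inE => /orP[/eqP->|/sA].
Qed.

Lemma card_II_le_seq A s : uniq s -> [set` s] `<=` A -> `I_(size s) #<= A.
Proof.
move=> us sA; rewrite -(card_le_eql (card_uniq_seq us)); exact: subset_card_le.
Qed.

Lemma card_uniq_le_II A s n :
  A #<= `I_n -> uniq s -> [set` s] `<=` A -> (size s <= n)%N.
Proof.
by move=> An us sA; rewrite -card_le_II; apply: card_le_trans An; apply: card_II_le_seq.
Qed.

End Counting.

(** * Prime and maximal ideals, prime avoidance *)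

Section Ideals.
Variable R : idomainType.
Implicit Types (I J P M N : set R) (a b u v : R).

Lemma is_proper_idealP I :
  is_proper_ideal I <->
  [/\ I 0, ~ I 1 & forall a u v, I u -> I v -> I (a * u + v)].
Proof.
split=> [[I0 I1 IM]|[I0 I1 IM]]; split.
- exact/set_mem.
- by move=> J1; move/negP: I1; apply; exact/mem_set.
- by move=> a u v Iu Iv; apply/set_mem/IM; exact/mem_set.
- exact/mem_set.
- by apply/negP => /set_mem.
- by move=> a u v /set_mem Iu /set_mem Iv; apply/mem_set/IM.
Qed.

Section Closure.
Variable I : set R.
Hypothesis pI : is_proper_ideal I.

Lemma ideal0 : I 0. Proof. by case/is_proper_idealP: pI. Qed.

Lemma ideal1 : ~ I 1. Proof. by case/is_proper_idealP: pI. Qed.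

Lemma idealD u v : I u -> I v -> I (u + v).
Proof. by case/is_proper_idealP: pI => _ _ /(_ 1 u v); rewrite mul1r. Qed.

Lemma ideal_mull a u : I u -> I (a * u).
Proof.
case/is_proper_idealP: pI => I0 _ /(_ a u 0) + Iu; rewrite addr0; exact.
Qed.

Lemma ideal_mulr a u : I u -> I (u * a).
Proof. by move=> Iu; rewrite mulrC; exact: ideal_mull. Qed.

Lemma idealN u : I u -> I (- u).
Proof. by move=> Iu; rewrite -mulN1r; exact: ideal_mull. Qed.

Lemma idealB u v : I u -> I v -> I (u - v).
Proof. by move=> Iu Iv; apply/idealD/idealN. Qed.

Lemma idealDr u v : I u -> I (u + v) -> I v.
Proof. by move=> Iu Iuv; rewrite -(addKr u v); apply: idealD => //; exact: idealN. Qed.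

Lemma idealDl u v : I v -> I (u + v) -> I u.
Proof. by rewrite addrC; exact: idealDr. Qed.

End Closure.

Lemma prime_ideal_proper P : is_prime_ideal P -> is_proper_ideal P.
Proof. by case. Qed.

Lemma prime_idealM P u v : is_prime_ideal P -> P (u * v) -> P u \/ P v.
Proof.
by case=> _ pP /mem_set /pP /orP[] /set_mem; [left|right].
Qed.

Lemma prime_idealNM P u v : is_prime_ideal P -> ~ P u -> ~ P v -> ~ P (u * v).
Proof. by move=> pP Pu Pv /(prime_idealM pP)[]. Qed.

Lemma prime_idealX P u n : is_prime_ideal P -> P (u ^+ n) -> P u.
Proof.
move=> pP; elim: n => [|n IHn]; first by move/(ideal1 (prime_ideal_proper pP)).
by rewrite exprS => /(prime_idealM pP)[|/IHn].
Qed.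

Lemma maximal_ideal_proper M : is_maximal_ideal M -> is_proper_ideal M.
Proof. by case. Qed.

(** If [u * v] is in [M] and [v] is not, the colon ideal [J] of [M] by [v] is proper and contains
    [M], hence equals [M]; but it contains [u]. *)
Lemma maximal_ideal_prime M : is_maximal_ideal M -> is_prime_ideal M.
Proof.
move=> [pM mM]; split=> // u v /set_mem Muv.
apply/orP; apply: contrapT => /not_orP[uM vM].
pose J := [set w | M (w * v)].
suff JM : J = M.
  apply: uM; apply/mem_set; rewrite -JM /J /=; exact: Muv.
apply: mM; last by move=> w Mw; rewrite /J /=; exact: (ideal_mulr pM).
apply/is_proper_idealP; rewrite /J /=; split.
- by rewrite mul0r; exact: (ideal0 pM).
- by rewrite mul1r => Mv; apply: vM; exact/mem_set.
- move=> a x y Mx My; rewrite mulrDl -mulrA.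
  by apply: (idealD pM) => //; exact: (ideal_mull pM).
Qed.

Lemma sub_maximal_ideal I :
  is_proper_ideal I -> exists2 M, is_maximal_ideal M & I `<=` M.
Proof.
move=> pI.
(* Zorn is applied to the sets whose union with [I] is a proper ideal: this property also holds for
   the empty set, which is the union of the empty chain. *)
have [F FP tF|A [pA mA]] := @Zorn_bigcup _ [set X | is_proper_ideal (X `|` I)].
  apply/is_proper_idealP; split.
  - by right; exact: (ideal0 pI).
  - move=> [[X FX X1]|]; last exact: (ideal1 pI).
    by apply: (ideal1 (FP _ FX)); left.
  - move=> a u v.
    suff H X Y : F X -> F Y -> (X `|` I) u -> (Y `|` I) v ->
        (\bigcup_(Z in F) Z `|` I) (a * u + v).
      move=> [[X FX Xu]|Iu] [[Y FY Yv]|Iv].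
      + by apply: (H X Y) => //; left.
      + by apply: (H X X) => //; [left|right].
      + by apply: (H Y Y) => //; [right|left].
      + by right; apply: (idealD pI) => //; exact: (ideal_mull pI).
    move=> FX FY XIu YIv.
    have [Z FZ [ZIu ZIv]] : exists2 Z, F Z & (Z `|` I) u /\ (Z `|` I) v.
      have [XY|YX] := tF _ _ FX FY.
        by exists Y => //; split=> //; case: XIu => [/XY|]; [left|right].
      by exists X => //; split=> //; case: YIv => [/YX|]; [left|right].
    have : (Z `|` I) (a * u + v).
      by apply: (idealD (FP _ FZ)) => //; exact: (ideal_mull (FP _ FZ)).
    by case=> [Zw|Iw]; [left; exists Z|right].
exists (A `|` I); last exact: subsetUr.
split=> // J pJ AIJ; apply/seteqP; split=> //.
apply: contrapT => JAI; apply: (mA J).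
  split; last by move=> JA; apply: JAI; apply: subset_trans JA (@subsetUl _ _ _).
  exact: subset_trans (@subsetUl _ _ _) AIJ.
by rewrite /= (setUidl (subset_trans (@subsetUr _ _ _) AIJ)).
Qed.

Lemma maximal_idealNsub M N :
  is_maximal_ideal M -> is_proper_ideal N -> M <> N -> ~ M `<=` N.
Proof. by move=> [_ mM] pN MN /(mM _ pN)/esym. Qed.

(** Induction on the list: if the element [a] found for the tail lies in the new prime [P], it is
    corrected to [a + b], where [b] is in [I], outside [P], and in every tail prime not contained in
    [P]. *)
Lemma prime_avoidance I (s : seq (set R)) :
  is_proper_ideal I -> (forall P, P \in s -> is_prime_ideal P /\ ~ I `<=` P) ->
  exists2 a, I a & forall P, P \in s -> ~ P a.
Proof.
move=> pI; elim: s => [|P s IHs] sP; first by exists 0 => //; exact: (ideal0 pI).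
have {}/IHs [a Ia sa] L : L \in s -> is_prime_ideal L /\ ~ I `<=` L.
  by move=> Ls; apply: sP; rewrite inE Ls orbT.
have [pP /existsNP[i /not_implyP[Ii Pi]]] := sP P (mem_head _ _).
have [Pa|Pa] := pselect (P a); last first.
  by exists a => // L; rewrite inE => /orP[/eqP->|/sa].
(* [L] contained in [P] is avoided as soon as [P] is *)
have [b [Ib Pb sb]] : exists b,
    [/\ I b, ~ P b & forall L, L \in s -> L `<=` P \/ L b].
  elim: s {sa} sP => [|L s IHs] sP.
    by exists i; split.
  have {}/IHs [b [Ib Pb sb]] L' : L' \in P :: s -> is_prime_ideal L' /\ ~ I `<=` L'.
    by rewrite inE => L's; apply: sP; rewrite !inE; case/orP: L's => ->; rewrite ?orbT.
  have [LP|] := pselect (L `<=` P).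
    exists b; split=> // L'; rewrite inE => /orP[/eqP->|/sb//]; by left.
  move=> /existsNP[l /not_implyP[Ll Pl]]; exists (l * b); split.
  - exact: (ideal_mull pI).
  - exact: prime_idealNM.
  - have pL L' : L' \in s -> is_proper_ideal L'.
      by move=> L's; apply: prime_ideal_proper; apply: (sP L' _).1; rewrite !inE L's !orbT.
    move=> L'; rewrite inE => /orP[/eqP->|L's].
      right; apply: ideal_mulr => //.
      by apply: prime_ideal_proper; apply: (sP L _).1; rewrite !inE eqxx orbT.
    by case: (sb _ L's) => [|L'b]; [left|right; apply: ideal_mull => //; exact: pL].
exists (a + b); first exact: (idealD pI).
move=> L; rewrite inE => /orP[/eqP->|Ls].
  by move/(idealDr (prime_ideal_proper pP) Pa).
have pL : is_proper_ideal L.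
  by apply: prime_ideal_proper; apply: (sP L _).1; rewrite inE Ls orbT.
case: (sb L Ls) => [LP /LP|Lb /(idealDl pL Lb)]; last exact: sa.
by move/(idealDr (prime_ideal_proper pP) Pa).
Qed.

End Ideals.

(** * Localizations inside the fraction field and their finite intersections *)

Section Localization.
Variable R : idomainType.
Implicit Types (I J P Q L M N : set R) (a b r t u v : R).
Implicit Types (x y z : {fraction R}) (s : seq (set R)).

Local Notation F := (@tofrac R).
Local Notation base := (base_ring R).

Lemma is_subring_base : is_subring base.
Proof.
apply/is_subringP; split; first by exists 1; rewrite ?tofrac1.
- by move=> _ _ [a _ <-] [b _ <-]; exists (a - b); rewrite ?tofracB.
- by move=> _ _ [a _ <-] [b _ <-]; exists (a * b); rewrite ?tofracM.
Qed.

Lemma mem_base r : base (F r). Proof. by exists r. Qed.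

Lemma frac_neq0 P a : is_proper_ideal P -> ~ P a -> F a != 0.
Proof.
move=> pP Pa; rewrite tofrac_eq0; apply/eqP => a0.
by apply: Pa; rewrite a0; exact: ideal0.
Qed.

Lemma quotient_field_base A x : base `<=` A -> quotient_field A x.
Proof.
move=> bA; have [a [b b0 ->]] := fraction_divP x.
exists (F a); first exact/bA/mem_base.
exists (F b) => //; split; first exact/bA/mem_base.
by apply/eqP; rewrite tofrac_eq0.
Qed.

Definition loc P : set {fraction R} := [set x | exists2 t, ~ P t & base (x * F t)].

Lemma is_subring_loc P : is_prime_ideal P -> is_subring (loc P).
Proof.
move=> pP; have ppP := prime_ideal_proper pP; apply/is_subringP; split.
- exists 1; first exact: ideal1.
  by rewrite mul1r; exact: mem_base.
- move=> x y [t Pt xt] [w Pw yw]; exists (t * w); first exact: prime_idealNM.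
  have -> : (x - y) * F (t * w) = x * F t * F w - y * F w * F t.
    by rewrite tofracM; ring.
  by apply: (subringB is_subring_base);
    apply: (subringM is_subring_base) => //; exact: mem_base.
- move=> x y [t Pt xt] [w Pw yw]; exists (t * w); first exact: prime_idealNM.
  by rewrite tofracM mulrACA; exact: (subringM is_subring_base).
Qed.

Lemma base_loc P : is_proper_ideal P -> base `<=` loc P.
Proof. by move=> pP x bx; exists 1; [exact: ideal1|rewrite tofrac1 mulr1]. Qed.

Lemma loc_frac P r t : is_proper_ideal P -> ~ P t -> loc P (F r / F t).
Proof.
move=> pP Pt; exists t => //; rewrite divfK; first exact: mem_base.
exact: frac_neq0 Pt.
Qed.

Lemma loc_inv P t : is_proper_ideal P -> ~ P t -> loc P (F t)^-1.
Proof. by move=> pP Pt; rewrite -[X in loc P X]mul1r -tofrac1; exact: loc_frac. Qed.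

Lemma sub_loc P Q : P `<=` Q -> loc Q `<=` loc P.
Proof. by move=> PQ x [t Qt xt]; exists t => // /PQ. Qed.

Lemma loc_inv_mem P t : is_prime_ideal P -> t != 0 -> loc P (F t)^-1 -> ~ P t.
Proof.
move=> pP t0 [w Pw [r _ e]] Pt; apply: Pw.
suff -> : w = r * t by apply: (ideal_mull (prime_ideal_proper pP)).
by apply/eqP; rewrite -tofrac_eq tofracM e mulrAC mulVf ?mul1r // tofrac_eq0.
Qed.

(** For [x] outside [R] the ideal of its denominators is proper, so it lies in some maximal [M], and
    then [x] is not in [loc M]. *)
Lemma base_bigcap_loc x : (forall M, is_maximal_ideal M -> loc M x) -> base x.
Proof.
move=> locx; apply: contrapT => nx.
have [|M mM IM] := @sub_maximal_ideal R [set t | base (x * F t)].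
  apply/is_proper_idealP; split=> /=.
  - by rewrite tofrac0 mulr0 -tofrac0; exact: mem_base.
  - by rewrite tofrac1 mulr1.
  - move=> a u v xu xv; rewrite tofracD tofracM mulrDr mulrCA.
    apply: (subringD is_subring_base) => //; apply: (subringM is_subring_base) => //.
    exact: mem_base.
by have [t Mt /IM] := locx _ mM.
Qed.

Lemma base_unit a : ~ (exists2 M, is_maximal_ideal M & M a) -> base (F a)^-1.
Proof.
move=> Na; apply: base_bigcap_loc => M mM.
by apply: loc_inv; [exact: maximal_ideal_proper|move=> Ma; apply: Na; exists M].
Qed.

Definition locs s : set {fraction R} := \bigcap_(P in [set` s]) loc P.

Definition all_prime s := forall P, P \in s -> is_prime_ideal P.

Lemma is_subring_locs s : all_prime s -> is_subring (locs s).
Proof. by move=> ps; apply: is_subring_bigcap => P /= /ps; exact: is_subring_loc. Qed.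

Lemma base_locs s : all_prime s -> base `<=` locs s.
Proof. by move=> ps x bx P /= /ps/prime_ideal_proper/base_loc; exact. Qed.

Lemma locs_inv s t : all_prime s -> (forall P, P \in s -> ~ P t) -> locs s (F t)^-1.
Proof.
by move=> ps st P /= Ps; apply: loc_inv; [exact: prime_ideal_proper (ps _ Ps)|exact: st].
Qed.

(** [P] contains [m], so [m] is not a unit; [Q] contains [p] but not [m], so [p] divides no power of
    [m]. *)
Lemma locs_arm s P Q m p : all_prime s -> locs s `<=` loc P -> locs s `<=` loc Q ->
  is_prime_ideal P -> is_prime_ideal Q -> p != 0 -> P m -> Q p -> ~ Q m ->
  locs s (F p / F m) -> arm (locs s) (F m) (F p).
Proof.
move=> ps sP sQ pP pQ p0 Pm Qp Qm spm.
have ppQ := prime_ideal_proper pQ.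
split=> //; first exact/base_locs/mem_base.
  by move/sP/(loc_inv_mem pP); apply=> //; apply/eqP => m0; apply: Qm; rewrite m0;
    exact: ideal0.
move=> k /sQ[w Qw [r _ e]].
have: Q (m ^+ k * w).
  suff -> : m ^+ k * w = r * p by exact: (ideal_mull ppQ).
  apply/eqP; rewrite -tofrac_eq !tofracM tofracXn e mulrAC divfK //.
  by rewrite tofrac_eq0.
by case/(prime_idealM pQ) => // /(prime_idealX pQ).
Qed.

Definition gadget s1 s2 : Prop := exists m p,
  [/\ arm (locs (s1 ++ s2)) (F m) (F p), forall P, P \in s1 -> P p
    & forall P, P \in s2 -> ~ P p].

Lemma locs_catC s1 s2 : locs (s1 ++ s2) = locs (s2 ++ s1).
Proof.
by apply/seteqP; split=> x sx P /=; rewrite mem_cat orbC -mem_cat => /sx.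
Qed.

(** Each listed prime contains exactly one of [p] and [q]. Hence [p + q] is a unit of the
    intersection, and its inverse serves as both Bezout coefficients. *)
Lemma gadgets_not_valuative s1 s2 : all_prime (s1 ++ s2) ->
  gadget s1 s2 -> gadget s2 s1 -> ~ valuative (locs (s1 ++ s2)).
Proof.
move=> ps [m [p [mp s1p s2p]]] [n [q [nq s2q s1q]]].
rewrite locs_catC in nq.
have sl := is_subring_locs ps; have bl := base_locs ps.
have pq P : P \in s1 ++ s2 -> ~ P (p + q).
  move=> Ps; have pP := prime_ideal_proper (ps _ Ps).
  move: Ps; rewrite mem_cat => /orP[P1|P2].
    by move/(idealDr pP (s1p _ P1)); exact: s1q.
  by move/(idealDl pP (s2q _ P2)); exact: s2p.
(* The empty intersection is the whole field, where [m] has its inverse; so an arm forces a nonempty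
   list. *)
have [P Ps] : exists P, P \in s1 ++ s2.
  apply: contrapT => noP; case: mp => _ _ + _; apply => P Ps.
  by case: noP; exists P.
have pq0 := frac_neq0 (prime_ideal_proper (ps _ Ps)) (pq _ Ps).
have spq := locs_inv ps pq.
apply: (two_arms_not_valuative sl mp nq _ _ spq spq).
- exact/bl/mem_base.
- exact/bl/mem_base.
- by rewrite -mulrDr -tofracD mulVf.
Qed.

(** * Valuation localizations and the construction of gadgets from primes *)

Definition loc_valuation M : Prop := forall x, loc M x \/ loc M x^-1.

(** One of [p] and [m] divides the other in the valuation ring [loc M], and [p] cannot divide [m],
    as this would put [m] in [P]. *)
Lemma loc_frac_sub M P p m : is_proper_ideal M -> loc_valuation M ->
  is_prime_ideal P -> P `<=` M -> P p -> ~ P m -> loc M (F p / F m).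
Proof.
move=> pM vM pP PM Pp Pm; have ppP := prime_ideal_proper pP.
have [->|p0] := eqVneq p 0.
  by rewrite tofrac0 mul0r -tofrac0; exact/(base_loc pM)/mem_base.
have [//|[w Mw [r _]]] := vM (F p / F m).
rewrite invf_div => e.
have: P (m * w).
  suff -> : m * w = r * p by exact: ideal_mull.
  apply/eqP; rewrite -tofrac_eq !tofracM e mulrAC divfK //.
  by rewrite tofrac_eq0.
by case/(prime_idealM pP) => // /PM.
Qed.

Lemma loc_valuation_comparable M P Q : is_proper_ideal M -> loc_valuation M ->
  is_prime_ideal P -> is_prime_ideal Q -> P `<=` M -> Q `<=` M ->
  incl_comparable P Q.
Proof.
move=> pM vM pP pQ PM QM; apply: contrapT => /not_orP[].
move=> /existsNP[a /not_implyP[Pa Qa]] /existsNP[b /not_implyP[Qb Pb]].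
have [w Mw [r _]] := loc_frac_sub pM vM pP PM Pa Pb.
move=> e; have: Q (a * w).
  suff -> : a * w = r * b by apply: (ideal_mull (prime_ideal_proper pQ)).
  apply/eqP; rewrite -tofrac_eq !tofracM e mulrAC divfK //.
  exact: frac_neq0 (prime_ideal_proper pP) Pb.
by case/(prime_idealM pQ) => // /QM.
Qed.

(** Prime avoidance gives [p] in [P1] outside the primes of [s], and [m] in [P2] outside these and
    [P1]. The quotient [p / m] lies in [loc P2] by the valuation property, and [m] is a unit at the
    primes of [s]. Although [P1] is not listed, it can detect divisibility because [loc P2] lies in
    [loc P1]. *)
Lemma chain_gadget M P1 P2 s : is_proper_ideal M -> loc_valuation M ->
  all_prime (P2 :: s) -> is_prime_ideal P1 -> P1 `<=` P2 -> ~ P2 `<=` P1 ->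
  P2 `<=` M -> (forall L, L \in s -> ~ P1 `<=` L) -> (exists L, L \in s) ->
  gadget [:: P2] s.
Proof.
move=> pM vM ps pP1 P12 P21 P2M P1s [L0 L0s].
have pP2 : is_prime_ideal P2 by apply: ps; rewrite mem_head.
have ps' L : L \in s -> is_prime_ideal L by move=> Ls; apply: ps; rewrite inE Ls orbT.
have [p P1p sp] : exists2 p, P1 p & forall L, L \in s -> ~ L p.
  apply: prime_avoidance; first exact: prime_ideal_proper.
  by move=> L Ls; split; [exact: ps'|exact: P1s].
have [m P2m sm] : exists2 m, P2 m & forall L, L \in P1 :: s -> ~ L m.
  apply: prime_avoidance; first exact: prime_ideal_proper.
  move=> L; rewrite inE => /orP[/eqP->//|Ls].
  split; first exact: ps'.
  by move=> P2L; apply: (P1s L Ls); exact: subset_trans P2L.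
have P1m : ~ P1 m by apply: sm; rewrite mem_head.
have sm' L : L \in s -> ~ L m by move=> Ls; apply: sm; rewrite inE Ls orbT.
exists m, p; split=> //; last by move=> P; rewrite inE => /eqP->; exact: P12.
have sP2 : locs ([:: P2] ++ s) `<=` loc P2 by move=> x; apply; exact: mem_head.
apply: (@locs_arm _ P2 P1) => //; first exact: subset_trans (sub_loc P12).
  by rewrite -tofrac_eq0; apply: frac_neq0 (sp _ L0s); apply/prime_ideal_proper/ps'.
move=> L /=; rewrite inE => /orP[/eqP->|Ls].
  apply: (sub_loc P2M); apply: (loc_frac_sub pM vM pP1) => //.
  exact: subset_trans P2M.
by apply: loc_frac; [exact/prime_ideal_proper/ps'|exact: sm'].
Qed.

(** Take [a] in [P] only and [b] in [Q] only, among the listed primes. The arm is [m = a],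
    [p = a * b]: [P] contains [a], while [Q] contains [a * b] but not [a]. *)
Lemma pair_gadget P Q s : all_prime [:: P, Q & s] -> ~ P `<=` Q -> ~ Q `<=` P ->
  (forall L, L \in s -> ~ P `<=` L /\ ~ Q `<=` L) -> gadget [:: P; Q] s.
Proof.
move=> ps PQ QP PQs.
have pP : is_prime_ideal P by apply: ps; rewrite mem_head.
have pQ : is_prime_ideal Q by apply: ps; rewrite !inE eqxx orbT.
have ps' L : L \in s -> is_prime_ideal L.
  by move=> Ls; apply: ps; rewrite !inE Ls !orbT.
have ppP := prime_ideal_proper pP; have ppQ := prime_ideal_proper pQ.
have [a Pa sa] : exists2 a, P a & forall L, L \in Q :: s -> ~ L a.
  apply: prime_avoidance => // L; rewrite inE => /orP[/eqP->//|Ls].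
  by split; [exact: ps'|case: (PQs L Ls)].
have [b Qb sb] : exists2 b, Q b & forall L, L \in P :: s -> ~ L b.
  apply: prime_avoidance => // L; rewrite inE => /orP[/eqP->//|Ls].
  by split; [exact: ps'|case: (PQs L Ls)].
have Qa : ~ Q a by apply: sa; rewrite mem_head.
have Pb : ~ P b by apply: sb; rewrite mem_head.
have a0 := frac_neq0 ppQ Qa; have b0 := frac_neq0 ppP Pb.
exists a, (a * b); split.
- apply: (@locs_arm _ P Q) => //.
  + by move=> x; apply; exact: mem_head.
  + by move=> x; apply; rewrite /= !inE eqxx orbT.
  + by rewrite mulf_neq0 // -tofrac_eq0.
  + exact: ideal_mull.
  + rewrite tofracM mulrC mulKf //; exact/(base_locs ps)/mem_base.
- by move=> L; rewrite !inE => /orP[] /eqP->; [exact: ideal_mulr|exact: ideal_mull].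
- move=> L Ls; apply: prime_idealNM; first exact: ps'.
    by apply: sa; rewrite inE Ls orbT.
  by apply: sb; rewrite inE Ls orbT.
Qed.

(** An element [e] of [N] outside all listed primes is a unit of the intersection but not of [R]. So
    the intersection is a proper overring and must be valuative, against the two gadgets. *)
Lemma no_gadgets s1 s2 N : maximal_non_valuative_domain R ->
  all_prime (s1 ++ s2) -> gadget s1 s2 -> gadget s2 s1 ->
  is_maximal_ideal N -> (forall P, P \in s1 ++ s2 -> ~ N `<=` P) -> False.
Proof.
move=> [_ maxR] ps g1 g2 mN sN.
apply: (gadgets_not_valuative ps g1 g2); apply: maxR.
  by split; [exact: is_subring_locs|exact: base_locs].
split; first exact: base_locs.
have [e Ne se] : exists2 e, N e & forall L, L \in s1 ++ s2 -> ~ L e.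
  apply: prime_avoidance; first exact: maximal_ideal_proper.
  by move=> L Ls; split; [exact: ps|exact: sN].
move=> /(_ _ (locs_inv ps se)) be.
have pN := maximal_ideal_proper mN.
move: Ne; apply: (loc_inv_mem (maximal_ideal_prime mN)); last exact: (base_loc pN).
have [P Ps] : exists P, P \in s1 ++ s2.
  case: g1 => m [p [[_ _ + _] _ _]] => mp.
  apply: contrapT => noP; apply: mp => P Ps.
  by case: noP; exists P.
rewrite -tofrac_eq0; exact: frac_neq0 (prime_ideal_proper (ps _ Ps)) (se _ Ps).
Qed.

End Localization.

(** * Polynomial relations over an integrally closed domain *)

Section IntegrallyClosed.
Variable R : idomainType.
Implicit Types (P Q L M N : set R) (a b r t u v : R) (f g : {poly R}).
Implicit Types (x y z : {fraction R}).

Local Notation F := (@tofrac R).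
Local Notation base := (base_ring R).
Local Notation "f ^F" := (map_poly F f) (at level 2, format "f ^F").

Lemma integral_lead_coefM f x :
  (1 < size f)%N -> root f^F x -> integralOver F (F (lead_coef f) * x).
Proof.
move=> sf /rootP fx; set a := lead_coef f.
have [n sfE] : exists n, size f = n.+2 by case: (size f) sf => [|[|n]] // _; exists n.
have aE : a = f`_n.+1 by rewrite /a lead_coefE sfE.
(* With [n + 1] the degree of [f], these coefficients make [a ^+ n * f(x)] a monic polynomial in
   [a * x]; at the top, [a] itself supplies the missing factor. *)
pose E i := if i == n.+1 then 1 else f`_i * a ^+ (n - i).
exists (\poly_(i < n.+2) E i).
  by rewrite monicE lead_coef_poly //= /E eqxx ?oner_eq0.
apply/rootP; rewrite (@horner_coef_wide _ n.+2); last first.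
  exact: leq_trans (size_poly _ _) (size_poly _ _).
transitivity (F a ^+ n * f^F.[x]); last by rewrite fx mulr0.
rewrite (@horner_coef_wide _ n.+2) ?(leq_trans (size_poly _ _)) ?sfE //.
rewrite mulr_sumr; apply: eq_bigr => -[i lti] _ /=.
rewrite !coef_map coef_poly lti /E /=; case: eqP => [->|/eqP ni].
  by rewrite -aE rmorph1 mul1r exprMn exprS /=; ring.
have lein : (i <= n)%N by rewrite -ltnS ltn_neqAle ni.
rewrite rmorphM rmorphXn exprMn -[in RHS](subnK lein) exprD /=; ring.
Qed.

Hypothesis icR : integrally_closed_domain R.

(* A variant of the [u, u^-1] lemma: the leading term of the relation is
   absorbed into the next one, since [lead_coef f * x] is integral over [R]. *)
Lemma root_loc P f x : is_prime_ideal P -> root f^F x ->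
  (exists i, ~ P f`_i) -> loc P x \/ loc P x^-1.
Proof.
move=> pP; have ppP := prime_ideal_proper pP.
have [n] := ubnP (size f); elim: n f => // n IHn f; rewrite ltnS => sfn fx [i Pi].
have [sf|sf] := leqP (size f) 1.
  case: Pi; move: fx; rewrite (size1_polyC sf) map_polyC rootC /= tofrac_eq0.
  by move/eqP->; rewrite polyC0 coef0; exact: ideal0.
have [r _ rE] := icR (integral_lead_coefM sf fx).
have [k sfE] : exists k, size f = k.+2 by case: (size f) sf => [|[|k]] // _; exists k.
move: rE; set a := lead_coef f => rE.
have aE : a = f`_k.+1 by rewrite /a lead_coefE sfE.
have a0 : F a != 0 by rewrite tofrac_eq0 lead_coef_eq0 -size_poly_eq0 sfE.
have xE : x = F r / F a by rewrite rE mulrC mulKf.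
have [Pa|Pa] := pselect (P a); last by left; rewrite xE; exact: loc_frac.
have [Pr|Pr] := pselect (P r); last first.
  by right; rewrite xE invf_div; exact: loc_frac.
pose g := f - a *: 'X^(k.+1) + r *: 'X^k.
have gE j : g`_j = f`_j - a * (j == k.+1)%:R + r * (j == k)%:R.
  by rewrite /g coefD coefB !coefZ !coefXn.
apply: (IHn g).
- apply: leq_trans sfn; rewrite sfE ltnS; apply/leq_sizeP => j kj.
  rewrite gE (gtn_eqF kj) mulr0 addr0.
  case: eqVneq => [->|jk]; first by rewrite -aE mulr1 subrr.
  by rewrite mulr0 subr0 nth_default // sfE ltn_neqAle eq_sym jk.
- apply/rootP; rewrite /g rmorphD rmorphB /= !map_polyZ /= !map_polyXn.
  by rewrite !hornerE (rootP fx) rE exprS sub0r mulrA addNr.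
(* Both [a] and [r] lie in [P], so [f] and [g] agree modulo [P] and the coefficient outside [P]
   survives. *)
- exists i => Pg; apply: Pi.
  have -> : f`_i = g`_i + (a * (i == k.+1)%:R - r * (i == k)%:R) by rewrite gE; ring.
  by apply: idealD => //; apply: idealB => //; exact: ideal_mulr.
Qed.

Lemma adjoin_loc_poly P y z : is_prime_ideal P -> adjoin (loc P) y z ->
  exists2 t, ~ P t & exists f, z * F t = f^F.[y].
Proof.
move=> pP; have ppP := prime_ideal_proper pP; move: z; apply: adjoin_min.
- apply/is_subringP; split=> /=.
  + by exists 1; [exact: ideal1|exists 1; rewrite tofrac1 rmorph1 !hornerE].
  + move=> z w [t Pt [f zE]] [u Pu [g wE]].
    exists (t * u); first exact: prime_idealNM.
    exists (u *: f - t *: g).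
    by rewrite rmorphB /= !map_polyZ /= !hornerE -zE -wE tofracM; ring.
  + move=> z w [t Pt [f zE]] [u Pu [g wE]].
    exists (t * u); first exact: prime_idealNM.
    by exists (f * g); rewrite tofracM rmorphM hornerM -zE -wE mulrACA.
- move=> z [t Pt [r _ rE]]; exists t => //; exists r%:P.
  by rewrite map_polyC hornerC.
- exists 1; first exact: ideal1.
  by exists 'X; rewrite map_polyX hornerX tofrac1 mulr1.
Qed.

(** If neither [x] nor [x^-1] is in [loc P], every relation over [R] satisfied by either has all its
    coefficients in [P]. Then adjoining the square gives a strictly intermediate ring: the relations
    [t *: 'X^2 - r] and [t *: 'X - f('X^2)] both have the coefficient [t] outside [P], since
    [f('X^2)] has no term of degree [1]. *)
Lemma valuative_loc_valuation P :
  is_prime_ideal P -> valuative (loc P) -> loc_valuation P.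
Proof.
move=> pP valP x; apply: contrapT => /not_orP[Px Pxi].
have ppP := prime_ideal_proper pP; have sP := is_subring_loc pP.
have no_root y : ~ loc P y -> ~ loc P y^-1 -> forall f i, root f^F y -> P f`_i.
  move=> Py Pyi f i fy; apply: contrapT => Pi.
  by case: (root_loc pP fy (ex_intro _ i Pi)).
have H y : ~ loc P y -> ~ loc P y^-1 -> ~ no_strictly_between (loc P) (adjoin (loc P) y).
  move=> Py Pyi /(_ (adjoin (loc P) (y ^+ 2))) [].
  - exact: adjoin_subring.
  - exact: sub_adjoin.
  - apply: adjoin_min; [exact: adjoin_subring|exact: sub_adjoin|].
    by apply: (subringX (adjoin_subring _ _)); exact: mem_adjoin.
  - move=> y2; have : loc P (y ^+ 2) by rewrite -y2; exact: mem_adjoin.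
    move=> [t Pt [r _ rE]]; apply: Pt.
    have := @no_root y Py Pyi (t *: 'X^2 - r%:P) 2%N.
    rewrite coefB coefZ coefXn coefC /= mulr1 subr0; apply; apply/rootP.
    rewrite rmorphB /= map_polyZ /= map_polyXn map_polyC !hornerE /= rE; ring.
  - move=> y2; have : adjoin (loc P) (y ^+ 2) y by rewrite y2; exact: mem_adjoin.
    move/(adjoin_loc_poly pP) => [t Pt [f yE]]; apply: Pt.
    have := @no_root y Py Pyi (t *: 'X - (f \Po 'X^2)) 1%N.
    rewrite coefB coefZ coefX coef_comp_poly_Xn //= mulr1 subr0; apply; apply/rootP.
    rewrite rmorphB /= map_polyZ /= map_polyX map_comp_poly map_polyXn !hornerE.
    by rewrite horner_comp hornerXn -yE; ring.
have x0 : x != 0 by apply/eqP => x0; apply: Px; rewrite x0; exact: subring0.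
case: (valP x (quotient_field_base x (base_loc ppP)) x0); first exact: H.
by apply: H => //; rewrite invrK.
Qed.

Lemma monic_not_unit_mod P f g : is_proper_ideal P -> f \is monic ->
  (1 < size f)%N -> exists i, ~ P (1 - f * g)`_i.
Proof.
move=> pP mf sf; have [n] := ubnP (size g); elim: n g => // n IHn g; rewrite ltnS => sg.
have [->|g0] := eqVneq g 0.
  by exists 0%N; rewrite mulr0 subr0 coefC; exact: ideal1.
have fg0 : f * g != 0 by rewrite mulf_neq0 // monic_neq0.
have [Pg|Pg] := pselect (P (lead_coef g)); last first.
  have k0 : (size (f * g)).-1 != 0%N.
    rewrite size_monicM //; move: sf g0; rewrite -size_poly_gt0.
    by case: (size f) => [|[|]] // n' _; case: (size g) => // ?; rewrite addnS.
  exists (size (f * g)).-1 => H; apply: Pg.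
  rewrite -(lead_coef_monicM g mf) lead_coefE -[X in P X]opprK.
  apply: idealN => //; move: H.
  by rewrite coefB coef1 (negPf k0) sub0r.
have [k sgE] : exists k, size g = k.+1 by exists (size g).-1; exact: polySpred.
pose h := g - lead_coef g *: 'X^k.
have [|i Pi] := IHn h.
  apply: leq_trans sg; rewrite sgE ltnS; apply/leq_sizeP => j kj.
  rewrite coefB coefZ coefXn.
  have [->|jk] := eqVneq j k; first by rewrite mulr1 lead_coefE sgE subrr.
  by rewrite mulr0 subr0 nth_default // sgE ltn_neqAle eq_sym jk.
exists i => H; apply: Pi.
have -> : 1 - f * h = (1 - f * g) + lead_coef g *: (f * 'X^k).
  by rewrite /h mulrBr -scalerAr; ring.
by rewrite coefD coefZ; apply: idealD => //; exact: ideal_mulr.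
Qed.

Lemma adjoin_base_poly y z : adjoin base y z -> exists f, z = f^F.[y].
Proof.
move: z; apply: adjoin_min.
- apply/is_subringP; split=> /=.
  + by exists 1; rewrite rmorph1 hornerE.
  + by move=> z w [f ->] [g ->]; exists (f - g); rewrite rmorphB !hornerE.
  + by move=> z w [f ->] [g ->]; exists (f * g); rewrite rmorphM hornerE.
- by move=> z [r _ <-]; exists r%:P; rewrite map_polyC hornerC.
- by exists 'X; rewrite map_polyX hornerX.
Qed.

Lemma horner_adjoin_base f y : adjoin base y f^F.[y].
Proof.
have sA := adjoin_subring base y.
elim/poly_ind: f => [|f c IHf]; first by rewrite rmorph0 horner0; exact: subring0.
rewrite rmorphD rmorphM /= map_polyX map_polyC !hornerE.
apply: (subringD sA); last by apply: sub_adjoin; exists c.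
by apply: (subringM sA) => //; exact: mem_adjoin.
Qed.

(* [R[x]] maps onto a polynomial ring over the residue field of [R], in which
   the images of [X], [X + 1], [X (X + 1) + 1] and
   [X (X + 1) (X (X + 1) + 1) + 1] are nonunits; they yield two arms. *)
Lemma local_adjoin_not_valuative M x : is_prime_ideal M ->
  (forall r, ~ M r -> base (F r)^-1) -> ~ base x -> ~ base x^-1 ->
  ~ valuative (adjoin base x).
Proof.
move=> pM unitM bx bxi; have ppM := prime_ideal_proper pM.
have locM : loc M `<=` base.
  move=> z [t Mt zt]; rewrite -(mulfK (frac_neq0 ppM Mt) z).
  by apply: (subringM (is_subring_base R)) => //; exact: unitM.
have no_root f : root f^F x -> forall i, M f`_i.
  move=> fx i; apply: contrapT => Mi.
  by case: (root_loc pM fx (ex_intro _ i Mi)) => /locM.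
pose e f := f^F.[x]; pose good f := f \is monic /\ (1 < size f)%N.
have eD f g : e (f + g) = e f + e g by rewrite /e rmorphD hornerD.
have eM f g : e (f * g) = e f * e g by rewrite /e rmorphM hornerM.
have e1 : e 1 = 1 by rewrite /e rmorph1 hornerE.
have sA := adjoin_subring base x; have Ae f : adjoin base x (e f).
  exact: horner_adjoin_base.
have nunit f : good f -> ~ adjoin base x (e f)^-1.
  move=> [mf sf] /adjoin_base_poly[g gE].
  have ef0 : e f != 0.
    apply/eqP => /rootP /no_root /(_ (size f).-1).
    by rewrite -lead_coefE (monicP mf); exact: ideal1.
  have [i] := monic_not_unit_mod g ppM mf sf; apply; apply: no_root.
  apply/rootP; rewrite rmorphB rmorph1 rmorphM !hornerE -gE.
  by rewrite mulfV ?subrr.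
have goodM f g : good f -> good g -> good (f * g).
  move=> [mf sf] [mg sg]; split; first exact: rpredM.
  rewrite size_monicM // ?monic_neq0 //.
  by case: (size f) sf (size g) sg => [|[|n]] // _ [|[|k]] // _; rewrite !addnS.
have good1 f : good f -> good (f + 1).
  move=> [mf sf]; have s1 : (size (1%R : {poly R}) < size f)%N by rewrite size_poly1.
  by split; [rewrite monicE lead_coefDl // -monicE|rewrite size_polyDl].
have goodX : good 'X by split; [exact: monicX|rewrite size_polyX].
pose p1 : {poly R} := 'X; pose p2 := p1 + 1; pose p3 := p1 * p2 + 1.
pose p4 := p1 * p2 * p3 + 1.
have g1 : good p1 by [].
have g2 : good p2 by exact: good1.
have g3 : good p3 by apply: good1; exact: goodM.
have g4 : good p4 by apply: good1; apply: (goodM) => //; exact: goodM.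
have A1 := subring1 sA; have AN1 := subringN sA A1.
have arm12 : arm (adjoin base x) (e p1) (e p1 * e p2).
  apply: (@comaximal_arm _ _ _ _ (-1) 1) => //; try exact: nunit.
  by rewrite [e p2]eD e1; ring.
have arm34 : arm (adjoin base x) (e p3) (e p3 * e p4).
  apply: (@comaximal_arm _ _ _ _ (- e (p1 * p2)) 1) => //; try exact: nunit.
    exact: (subringN sA).
  by rewrite [e p4]eD e1 !eM; ring.
(* With [p = p1 * p2] one has [p3 = p + 1] and [p4 = p * p3 + 1], hence
   [p3 * p4 = (p4 + p3) * p + 1]. *)
apply: (two_arms_not_valuative (u := - e (p1 * p2 * p3 + 1 + p3)) (v := 1) sA arm12 arm34) => //.
  exact: (subringN sA).
by rewrite /p4 /p3 !(eD, eM, e1); ring.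
Qed.

(** * Localizations at maximal ideals, and the case of two maximal ideals *)

Hypothesis mnvR : maximal_non_valuative_domain R.

Lemma valuative_overring A : is_subring A -> base `<=` A -> ~ A `<=` base -> valuative A.
Proof. by move=> sA bA Ab; apply: mnvR.2. Qed.

(** If [R] were local, each [x] would have [x] or [x^-1] in [R], as otherwise [R[x]] would be a non
    valuative proper overring. But then [R] would be valuative, with trivial extensions. *)
Lemma two_maximal_ideals :
  exists M N, [/\ is_maximal_ideal M, is_maximal_ideal N & M <> N].
Proof.
have [|M mM _] := @sub_maximal_ideal R [set 0].
  apply/is_proper_idealP; split=> //=; first by apply/eqP; rewrite oner_eq0.
  by move=> a u v -> ->; rewrite mulr0 addr0.
apply: contrapT => oneM.
have unitM r : ~ M r -> base (F r)^-1.
  move=> Mr; apply: base_unit => -[N mN Nr]; apply: oneM; exists M, N.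
  by split=> // MN; apply: Mr; rewrite MN.
apply: mnvR.1 => x _ x0.
have [bx|bx] := pselect (base x).
  left; rewrite adjoin_id //; first exact: no_strictly_between_refl.
  exact: is_subring_base.
have [bxi|bxi] := pselect (base x^-1).
  right; rewrite adjoin_id //; first exact: no_strictly_between_refl.
  exact: is_subring_base.
case: (local_adjoin_not_valuative (maximal_ideal_prime mM) unitM bx bxi).
apply: valuative_overring.
- exact: adjoin_subring.
- exact: sub_adjoin.
- by move=> /(_ x); apply: contra_not bx; apply; exact: mem_adjoin.
Qed.

Lemma maximal_loc_valuation M : is_maximal_ideal M -> loc_valuation M.
Proof.
move=> mM; have pM := maximal_ideal_prime mM; have ppM := maximal_ideal_proper mM.
apply: valuative_loc_valuation => //; apply: valuative_overring.
- exact: is_subring_loc.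
- exact: base_loc.
have [N mN MN] : exists2 N, is_maximal_ideal N & N <> M.
  have [M1 [M2 [m1 m2 M12]]] := two_maximal_ideals.
  have [M1M|] := pselect (M1 = M); last by exists M1.
  by exists M2 => // M2M; apply: M12; rewrite M1M M2M.
have /existsNP[n /not_implyP[Nn Mn]] := maximal_idealNsub mN ppM MN.
move=> /(_ _ (loc_inv ppM Mn)) /(base_loc (maximal_ideal_proper mN)).
move=> /(loc_inv_mem (maximal_ideal_prime mN)); apply=> //.
by rewrite -tofrac_eq0; exact: frac_neq0 Mn.
Qed.

Lemma nonunit_loc_valuation M y : is_prime_ideal M -> loc_valuation M ->
  loc M y -> loc M y^-1 \/ loc M (y + 1)^-1.
Proof.
move=> pM vM [t Mt [r _ rE]]; have ppM := prime_ideal_proper pM.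
have t0 := frac_neq0 ppM Mt.
have yE : y = F r / F t by rewrite rE mulfK.
have [Mr|Mr] := pselect (M r); last by left; rewrite yE invf_div; exact: loc_frac.
right; have -> : (y + 1)^-1 = F t / F (r + t).
  by rewrite yE -[X in _ + X](divff t0) -mulrDl -tofracD invf_div.
by apply: loc_frac => // /(idealDr ppM Mr).
Qed.

(* The primes [{r | r * y ^+ n \in loc M for all n}], for [y] outside [loc M],
   are non-maximal; hence they lie in [N], and their elements cannot have
   inverses in [loc N]. *)
Lemma two_maximal_minimal_extension M N x :
  is_maximal_ideal M -> is_maximal_ideal N ->
  (forall L, is_maximal_ideal L -> L = M \/ L = N) ->
  (forall P, non_maximal_primes R P -> P `<=` N) ->
  ~ loc M x -> ~ loc N x^-1 -> no_strictly_between base (adjoin base x).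
Proof.
move=> mM mN MN subN Mx Nxi C sC bC CA.
have [pM pN] := (maximal_ideal_prime mM, maximal_ideal_prime mN).
have [ppM ppN] := (prime_ideal_proper pM, prime_ideal_proper pN).
have [vM vN] := (maximal_loc_valuation mM, maximal_loc_valuation mN).
have [sM sN] := (is_subring_loc pM, is_subring_loc pN).
have Nx : loc N x by case: (vN x).
have bMN z : loc M z -> loc N z -> base z.
  by move=> Mz Nz; apply: base_bigcap_loc => L /MN[]->.
have AN : adjoin base x `<=` loc N.
  by apply: adjoin_min => //; exact: base_loc.
have [Cb|] := pselect (C `<=` base); first by left; exact/seteqP.
move=> /existsNP[y0 /not_implyP[Cy0 by0]]; right; apply/seteqP; split=> //.
apply: adjoin_min => //.
have Ny0 : loc N y0 by exact: AN (CA _ Cy0).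
(* Passing to [y0 + 1] if necessary makes [y] a unit of [loc N], so dividing by powers of [y] stays
   inside [loc N]. *)
have [y [Cy My Ny Nyi]] : exists y, [/\ C y, ~ loc M y, loc N y & loc N y^-1].
  have My0 : ~ loc M y0 by move=> My0; apply: by0; exact: bMN.
  have [Ny0i|Ny1i] := nonunit_loc_valuation pN vN Ny0; first by exists y0.
  exists (y0 + 1); split=> //.
  - by apply: (subringD sC) => //; exact: subring1.
  - move=> My1; apply: My0; rewrite -(addrK 1 y0).
    by apply: (subringB sM) => //; exact: subring1.
  - by apply: (subringD sN) => //; exact: subring1.
have y_neq0 : y != 0 by apply/eqP => y0E; apply: My; rewrite y0E; exact: subring0.
(* If some [x / y ^+ n] is in [loc M], it is in [R], the intersection of [loc M] and [loc N];
   multiplying back by [y ^+ n] puts [x] in [C]. *)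
have [[n Mxy]|noMxy] := pselect (exists n, loc M (x / y ^+ n)).
  rewrite -(divfK (expf_neq0 n y_neq0) x); apply: (subringM sC).
    apply/bC/bMN => //; apply: (subringM sN) => //.
    by rewrite -exprVn; exact: subringX.
  exact: subringX.
have Myx n : loc M (y ^+ n / x).
  case: (vM (x / y ^+ n)); last by rewrite invf_div.
  by move=> Mxy; case: noMxy; exists n.
pose P : set R := [set r | forall n, loc M (F r * y ^+ n)].
have pP : is_prime_ideal P.
  split.
    apply/is_proper_idealP; split=> [n|/(_ 1%N)|a u v Pu Pv n].
    - by rewrite tofrac0 mul0r; exact: subring0.
    - by rewrite tofrac1 mul1r expr1.
    - rewrite tofracD tofracM mulrDl -mulrA; apply: (subringD sM) => //.
      by apply: (subringM sM) => //; exact/(base_loc ppM)/mem_base.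
  move=> u v /set_mem Puv; apply/orP; apply: contrapT => /not_orP[uP vP].
  have /existsNP[i Mui] : ~ P u by move=> Pu; apply: uP; exact/mem_set.
  have /existsNP[j Mvj] : ~ P v by move=> Pv; apply: vP; exact/mem_set.
  apply: Mui; have vj0 : F v * y ^+ j != 0.
    by apply/eqP => vj0; apply: Mvj; rewrite vj0; exact: subring0.
  rewrite -(mulfK vj0 (F u * y ^+ i)); apply: (subringM sM).
    by rewrite mulrACA -exprD -tofracM.
  by case: (vM (F v * y ^+ j)).
have PM : P `<=` M.
  move=> r Pr; apply: contrapT => Mr; apply: My.
  rewrite -(mulKf (frac_neq0 ppM Mr) y); apply: (subringM sM).
    exact: loc_inv.
  by have := Pr 1%N; rewrite expr1.
(* Write [y^-1 = r / t] in [loc M]. If [P] were [M], then either [r] is in [P] and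
   [r * y ^+ 2 = t * y] puts [y] in [loc M], or [r] is outside [M] and [y = t / r] is there. *)
have nP : non_maximal_primes R P.
  split=> // mP; have MP : M = P by apply: mP.2.
  have [//|[t Mt [r _ rE]]] := vM y; have t0 := frac_neq0 ppM Mt.
  have [Mr|Mr] := pselect (M r).
    have := Mr; rewrite MP => /(_ 2%N).
    rewrite rE (_ : y^-1 * F t * y ^+ 2 = F t * y); last by field.
    move=> Mty; apply: My; rewrite -(mulKf t0 y); apply: (subringM sM) => //.
    exact: loc_inv.
  apply: My; rewrite (_ : y = F t / F r); first exact: loc_frac.
  by rewrite rE; field; rewrite ?t0 ?y_neq0.
have x0 : x != 0 by apply/eqP => x0; apply: Mx; rewrite x0; exact: subring0.
have := Myx 0%N; rewrite expr0 mul1r => -[t Mt [r _ rE]].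
have Pr : P r.
  move=> n; rewrite rE (_ : _ * _ = F t * (y ^+ n / x)); last by ring.
  by apply: (subringM sM) => //; exact/(base_loc ppM)/mem_base.
case: Nxi; rewrite (_ : x^-1 = F r / F t).
  apply: (loc_frac_sub ppN vN pP); [exact: subN|exact: Pr|by move/PM].
by rewrite rE mulfK //; exact: frac_neq0 Mt.
Qed.

(** Otherwise [R] would be valuative: one of [x], [x^-1] lies in [R] unless one is outside [loc M]
    and the other outside [loc N], and then the one outside [loc M] generates a minimal
    extension. *)
Lemma two_maximal_incomparable M N :
  is_maximal_ideal M -> is_maximal_ideal N ->
  (forall L, is_maximal_ideal L -> L = M \/ L = N) ->
  exists2 P, non_maximal_primes R P & ~ P `<=` N.
Proof.
move=> mM mN MN; apply: contrapT => noP.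
have subN P : non_maximal_primes R P -> P `<=` N.
  by move=> nP; apply: contrapT => PN; apply: noP; exists P.
have min := two_maximal_minimal_extension mM mN MN subN.
have [vM vN] := (maximal_loc_valuation mM, maximal_loc_valuation mN).
have bMN z : loc M z -> loc N z -> base z.
  by move=> Mz Nz; apply: base_bigcap_loc => L /MN[]->.
have triv z : base z -> no_strictly_between base (adjoin base z).
  move=> bz; rewrite adjoin_id //; first exact: no_strictly_between_refl.
  exact: is_subring_base.
apply: mnvR.1 => x _ x0.
have [Mx|Mx] := pselect (loc M x); have [Nx|Nx] := pselect (loc N x).
- by left; apply: triv; exact: bMN.
- have Nxi : loc N x^-1 by case: (vN x).
  right; have [Mxi|Mxi] := pselect (loc M x^-1); first by apply: triv; exact: bMN.
  by apply: min => //; rewrite invrK.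
- have Mxi : loc M x^-1 by case: (vM x).
  have [Nxi|Nxi] := pselect (loc N x^-1); first by right; apply: triv; exact: bMN.
  by left; exact: min.
- by right; apply: triv; apply: bMN; [case: (vM x)|case: (vN x)].
Qed.

(** * Excluded configurations of primes *)

Lemma two_chains_absurd P1 P2 Q1 Q2 L : is_prime_ideal P1 -> is_prime_ideal P2 ->
  is_prime_ideal Q1 -> is_prime_ideal Q2 -> P1 `<=` P2 -> ~ P2 `<=` P1 ->
  Q1 `<=` Q2 -> ~ Q2 `<=` Q1 -> ~ P1 `<=` Q2 -> ~ Q1 `<=` P2 ->
  is_maximal_ideal L -> ~ L `<=` P2 -> ~ L `<=` Q2 -> False.
Proof.
move=> pP1 pP2 pQ1 pQ2 P12 P21 Q12 Q21 PQ QP mL LP LQ.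
have [M mM P2M] := sub_maximal_ideal (prime_ideal_proper pP2).
have [N mN Q2N] := sub_maximal_ideal (prime_ideal_proper pQ2).
have [vM vN] := (maximal_loc_valuation mM, maximal_loc_valuation mN).
(* The two chains give a gadget in each direction on the intersection of [loc P2] and [loc Q2]; [L]
   makes this overring proper. *)
apply: (@no_gadgets R [:: P2] [:: Q2] L) => //.
- by move=> P; rewrite !inE => /orP[] /eqP->.
- apply: (chain_gadget (maximal_ideal_proper mM) vM _ pP1) => //.
  + by move=> P; rewrite !inE => /orP[] /eqP->.
  + by move=> P; rewrite inE => /eqP->.
  + by exists Q2; exact: mem_head.
- apply: (chain_gadget (maximal_ideal_proper mN) vN _ pQ1) => //.
  + by move=> P; rewrite !inE => /orP[] /eqP->.
  + by move=> P; rewrite inE => /eqP->.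
  + by exists P2; exact: mem_head.
- by move=> P; rewrite !inE => /orP[] /eqP->.
Qed.

Lemma incl_comparable_sym P Q : incl_comparable P Q -> incl_comparable Q P.
Proof. by case; [right|left]. Qed.

Lemma sub_maximal_comparable M P Q : is_maximal_ideal M ->
  is_prime_ideal P -> is_prime_ideal Q -> P `<=` M -> Q `<=` M ->
  incl_comparable P Q.
Proof.
move=> mM; apply: loc_valuation_comparable; first exact: maximal_ideal_proper.
exact: maximal_loc_valuation.
Qed.

Lemma prime_sub_nonmaximal P M : is_maximal_ideal M -> non_maximal_primes R P ->
  P `<=` M -> ~ M `<=` P.
Proof.
move=> mM [pP nP] PM MP; apply: nP.
by rewrite (_ : P = M) //; apply/seteqP.
Qed.

(** A further maximal ideal [L] would exclude the chains from [P] to [M] and from [Q] to [N]; these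
    are independent because primes inside one maximal ideal are comparable. *)
Lemma incomparable_two_maximal P Q M N L : non_maximal_primes R P ->
  non_maximal_primes R Q -> ~ incl_comparable P Q ->
  is_maximal_ideal M -> is_maximal_ideal N -> P `<=` M -> Q `<=` N ->
  is_maximal_ideal L -> L = M \/ L = N.
Proof.
move=> nP nQ PQ mM mN PM QN mL; apply: contrapT => /not_orP[LM LN].
have [[pP _] [pQ _]] := (nP, nQ).
apply: (@two_chains_absurd P M Q N L) => //.
- exact: maximal_ideal_prime.
- exact: maximal_ideal_prime.
- exact: prime_sub_nonmaximal.
- exact: prime_sub_nonmaximal.
- by move=> PN; apply: PQ; exact: (sub_maximal_comparable mN).
- by move=> QM; apply: PQ; exact: (sub_maximal_comparable mM).
- by apply: maximal_idealNsub => //; exact: maximal_ideal_proper.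
- by apply: maximal_idealNsub => //; exact: maximal_ideal_proper.
Qed.

(** Both primes lie in [M], hence are comparable. A strict inclusion would be a chain to set against
    the chain from [Q] to [N], with [Q] a non-maximal prime outside [M]; here [M] itself makes the
    overring proper. *)
Lemma two_maximal_unique M N P P' : is_maximal_ideal M -> is_maximal_ideal N ->
  (forall L, is_maximal_ideal L -> L = M \/ L = N) ->
  non_maximal_primes R P -> non_maximal_primes R P' -> ~ P `<=` N -> ~ P' `<=` N ->
  P = P'.
Proof.
move=> mM mN MN nP nP' PN P'N.
have subM Q : non_maximal_primes R Q -> ~ Q `<=` N -> Q `<=` M.
  move=> [pQ _] QN; have [L mL QL] := sub_maximal_ideal (prime_ideal_proper pQ).
  by case: (MN L mL) QL => ->.
have NM L : is_maximal_ideal L -> L = N \/ L = M by case/MN; [right|left].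
have [Q nQ QM] := two_maximal_incomparable mN mM NM.
have subN : Q `<=` N.
  have [L mL QL] := sub_maximal_ideal (prime_ideal_proper nQ.1).
  by case: (MN L mL) QL => ->.
have [PM P'M] := (subM _ nP PN, subM _ nP' P'N).
have H P1 P2 : non_maximal_primes R P1 -> non_maximal_primes R P2 ->
    ~ P1 `<=` N -> P1 `<=` P2 -> P2 `<=` M -> P1 = P2.
  move=> n1 n2 P1N P12 P2M; apply/seteqP; split=> //; apply: contrapT => P21.
  apply: (@two_chains_absurd P1 P2 Q N M) => //.
  - exact: n1.1.
  - exact: n2.1.
  - exact: nQ.1.
  - exact: maximal_ideal_prime.
  - exact: prime_sub_nonmaximal.
  - by move=> QP2; apply: QM; exact: subset_trans P2M.
  - exact: prime_sub_nonmaximal.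
  - apply: maximal_idealNsub => //; first exact: maximal_ideal_proper.
    by move=> MNe; apply: P1N; rewrite -MNe; exact: subset_trans P2M.
have [PP'|P'P] := sub_maximal_comparable mM nP.1 nP'.1 PM P'M; first exact: H.
by apply/esym; exact: H.
Qed.

(** Of five maximal ideals, two pairs provide the gadgets and the fifth makes the overring
    proper. *)
Lemma card_Max_le4 : Max R #<= `I_4.
Proof.
apply: contrapT => /card_le_II_seq[s [us ss sub]].
case: s us ss sub => [|M1 [|M2 [|M3 [|M4 [|M5 [|? ?]]]]]] // us _ sub.
have mMax L : L \in [:: M1; M2; M3; M4; M5] -> is_maximal_ideal L by exact: sub.
have [n1 /uniq_consP[n2 /uniq_consP[n3 /uniq_consP[n4 _]]]] := (uniq_consP _ _).1 us.
have [m1 m2 m3 m4 m5] : [/\ is_maximal_ideal M1, is_maximal_ideal M2,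
    is_maximal_ideal M3, is_maximal_ideal M4 & is_maximal_ideal M5].
  by split; apply: mMax; rewrite !in_cons eqxx ?orbT.
have [n12 n13 n14 n15] : [/\ M1 <> M2, M1 <> M3, M1 <> M4 & M1 <> M5].
  by split; apply: n1; rewrite !in_cons eqxx ?orbT.
have [n23 n24 n25] : [/\ M2 <> M3, M2 <> M4 & M2 <> M5].
  by split; apply: n2; rewrite !in_cons eqxx ?orbT.
have [n34 n35 n45] : [/\ M3 <> M4, M3 <> M5 & M4 <> M5].
  by split; [apply: n3|apply: n3|apply: n4]; rewrite !in_cons eqxx ?orbT.
have nsub (A B : set R) : is_maximal_ideal A -> is_maximal_ideal B ->
    A <> B -> ~ A `<=` B.
  by move=> mA mB AB; apply: maximal_idealNsub => //; exact: maximal_ideal_proper.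
apply: (@no_gadgets R [:: M1; M2] [:: M3; M4] M5) => //.
- move=> L; rewrite !inE => /or4P[] /eqP->; exact: maximal_ideal_prime.
- apply: pair_gadget; [|exact: nsub|exact/nsub/nesym|] => // L; rewrite !inE.
    case/or4P=> /eqP->; exact: maximal_ideal_prime.
  by case/orP=> /eqP->; split; exact: nsub.
- apply: pair_gadget; [|exact: nsub|exact/nsub/nesym|] => // L; rewrite !inE.
    case/or4P=> /eqP->; exact: maximal_ideal_prime.
  by case/orP=> /eqP->; split; exact/nsub/nesym.
- by move=> L; rewrite !inE => /or4P[] /eqP->; exact/nsub/nesym.
Qed.

Lemma three_maximal_comparable : (forall M N, is_maximal_ideal M ->
    is_maximal_ideal N -> exists L, [/\ is_maximal_ideal L, L <> M & L <> N]) ->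
  forall P Q, non_maximal_primes R P -> non_maximal_primes R Q ->
  incl_comparable P Q.
Proof.
move=> third P Q nP nQ; apply: contrapT => PQ.
have [M mM PM] := sub_maximal_ideal (prime_ideal_proper nP.1).
have [N mN QN] := sub_maximal_ideal (prime_ideal_proper nQ.1).
have [L [mL LM LN]] := third M N mM mN.
by case: (incomparable_two_maximal nP nQ PQ mM mN PM QN mL).
Qed.

(** A prime larger than one that escapes [M] also escapes [M], so the larger of the primes found for
    head and tail serves for both. *)
Lemma non_maximal_prime_outside (s : seq (set R)) :
  (forall P Q, non_maximal_primes R P -> non_maximal_primes R Q ->
    incl_comparable P Q) ->
  s != [::] ->
  (forall M, M \in s -> exists2 P, non_maximal_primes R P & ~ P `<=` M) ->
  exists2 P, non_maximal_primes R P & forall M, M \in s -> ~ P `<=` M.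
Proof.
move=> cmp; elim: s => // M s IHs _ sP.
have [P nP PM] := sP M (mem_head _ _).
have [s0|s0] := eqVneq s [::].
  by exists P => // L; rewrite s0 inE => /eqP->.
have [//|L Ls|Q nQ sQ] := IHs _; first by apply: sP; rewrite inE Ls orbT.
have [PQ|QP] := cmp P Q nP nQ.
  exists Q => // L; rewrite inE => /orP[/eqP->|/sQ//].
  by move=> QM; apply: PM; exact: subset_trans QM.
exists P => // L; rewrite inE => /orP[/eqP->//|/sQ QL PL].
by apply: QL; exact: subset_trans PL.
Qed.

(** Such a [P] lies in a fourth maximal ideal [M]. The chain from [P] to [M] is set against the pair
    [M1], [M2], and [M3] makes the overring proper. *)
Lemma three_maximal_absurd M1 M2 M3 : is_maximal_ideal M1 ->
  is_maximal_ideal M2 -> is_maximal_ideal M3 -> uniq [:: M1; M2; M3] ->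
  ~ exists2 P, non_maximal_primes R P &
      forall M, M \in [:: M1; M2; M3] -> ~ P `<=` M.
Proof.
move=> m1 m2 m3 /uniq_consP[n1 /uniq_consP[n2 _]].
have [n12 n13 n23] : [/\ M1 <> M2, M1 <> M3 & M2 <> M3].
  by split; [apply: n1|apply: n1|apply: n2]; rewrite !in_cons eqxx ?orbT.
move=> [P nP sP].
have [P1 P2 P3] : [/\ ~ P `<=` M1, ~ P `<=` M2 & ~ P `<=` M3].
  by split; apply: sP; rewrite !in_cons eqxx ?orbT.
have [M mM PM] := sub_maximal_ideal (prime_ideal_proper nP.1).
have nsub (A B : set R) : is_maximal_ideal A -> is_maximal_ideal B -> A <> B -> ~ A `<=` B.
  by move=> mA mB AB; apply: maximal_idealNsub => //; exact: maximal_ideal_proper.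
have neq L : ~ P `<=` L -> M <> L by move=> PL ML; apply: PL; rewrite -ML.
have mprime := @maximal_ideal_prime R.
have pM A B : is_prime_ideal A -> is_prime_ideal B -> all_prime [:: M; A; B].
  move=> pA pB L; rewrite !inE => /or3P[] /eqP->//; exact: mprime.
apply: (@no_gadgets R [:: M] [:: M1; M2] M3) => //.
- by apply: pM; exact: mprime.
- apply: (chain_gadget (maximal_ideal_proper mM) (maximal_loc_valuation mM) _ nP.1) => //.
  + by apply: pM; exact: mprime.
  + exact: prime_sub_nonmaximal.
  + by move=> L; rewrite !inE => /orP[] /eqP->.
  + by exists M1; exact: mem_head.
- apply: pair_gadget.
  + by move=> L; rewrite !inE => /or3P[] /eqP->; exact: mprime.
  + exact: nsub.
  + by apply: nsub => //; exact/nesym.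
  + move=> L; rewrite inE => /eqP->; split; apply: nsub => //; exact/nesym/neq.
- move=> L; rewrite !inE => /or3P[] /eqP->; apply: nsub => //.
  + exact/nesym/neq.
  + exact/nesym.
  + exact/nesym.
Qed.

End IntegrallyClosed.

(** * Deduction of the three statements from the excluded configurations *)

Theorem proposition2p8 (R : idomainType)
    (hR : maximal_non_valuative_domain R)
    (hic : integrally_closed_domain R) :
  (* (i) *)
  (`I_2 #<= Max R /\ Max R #<= `I_4) /\
  (* (ii) *)
  (Max R #= `I_2 ->
    exists P Q : set R,
      [/\ non_maximal_primes R P, non_maximal_primes R Q, ~ incl_comparable P Q &
        forall P' Q' : set R,
          non_maximal_primes R P' -> non_maximal_primes R Q' ->
          ~ incl_comparable P' Q' ->
          (P' = P /\ Q' = Q) \/ (P' = Q /\ Q' = P)]) /\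
  (~ (Max R #= `I_2) ->
    forall P Q : set R,
      non_maximal_primes R P -> non_maximal_primes R Q -> incl_comparable P Q) /\
  (* (iii) *)
  [set M | Max R M /\ ~ (forall P, non_maximal_primes R P -> P `<=` M)] #<= `I_2.
Proof.
have [M [N [mM mN MN]]] := two_maximal_ideals hic hR.
have ge2 : `I_2 #<= Max R.
  apply: (@card_II_le_seq _ (Max R) [:: M; N]).
    by apply/uniq_consP; split=> // L; rewrite inE => /eqP->.
  by move=> L /=; rewrite !inE => /orP[] /eqP->.
have cmp : ~ (Max R #= `I_2) -> forall P Q,
    non_maximal_primes R P -> non_maximal_primes R Q -> incl_comparable P Q.
  move=> M2; apply: (three_maximal_comparable hic hR) => A B mA mB.
  apply: contrapT => noL; apply: M2; rewrite card_eq_le ge2 andbT.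
  apply: contrapT => /card_le_II_seq[s [us ss sM]].
  suff: (size s <= 2)%N by rewrite ss.
  apply: (@uniq_leq_size _ _ [:: A; B] us) => L Ls.
  rewrite !inE; have [->|LA] := pselect (L = A); first by rewrite eqxx.
  have [->|LB] := pselect (L = B); first by rewrite eqxx orbT.
  by case: noL; exists L; split=> //; exact: sM.
split; first by split=> //; exact: card_Max_le4.
split=> [M2|]; last split=> //.
- have MaxMN L : is_maximal_ideal L -> L = M \/ L = N.
    move=> mL; apply: contrapT => /not_orP[LM LN].
    have : (size [:: L; M; N] <= 2)%N; last by [].
    apply: (@card_uniq_le_II _ (Max R)).
    + by move: M2; rewrite card_eq_le => /andP[].
    + apply/uniq_consP; split; first by move=> A; rewrite !inE => /orP[] /eqP->.
      by apply/uniq_consP; split=> // A; rewrite inE => /eqP->.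
    + by move=> L' /=; rewrite !inE => /or3P[] /eqP->.
  have MaxNM L : is_maximal_ideal L -> L = N \/ L = M by case/MaxMN; [right|left].
  have [P nP PN] := two_maximal_incomparable hic hR mM mN MaxMN.
  have [Q nQ QM] := two_maximal_incomparable hic hR mN mM MaxNM.
  have sub L : non_maximal_primes R L -> L `<=` M \/ L `<=` N.
    move=> [pL _]; have [L' mL' LL'] := sub_maximal_ideal (prime_ideal_proper pL).
    by case: (MaxMN L' mL') LL' => ->; [left|right].
  have PM : P `<=` M by case: (sub P nP).
  have QN : Q `<=` N by case: (sub Q nQ).
  have uP := two_maximal_unique hic hR mM mN MaxMN.
  have uQ := two_maximal_unique hic hR mN mM MaxNM.
  exists P, Q; split=> //.
    by case=> [PQ|QP]; [apply: PN|apply: QM]; apply: subset_trans; eassumption.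
  (* Incomparable primes share no maximal ideal, so each lies in just one of [M] and [N], where
     uniqueness identifies it. *)
  have H P' Q' : non_maximal_primes R P' -> non_maximal_primes R Q' ->
      ~ incl_comparable P' Q' -> P' `<=` M -> P' = P /\ Q' = Q.
    move=> nP' nQ' PQ' P'M.
    have Q'M : ~ Q' `<=` M.
      by move=> Q'M; apply: PQ'; exact: (sub_maximal_comparable hic hR mM nP'.1 nQ'.1).
    have Q'N : Q' `<=` N by case: (sub Q' nQ').
    have P'N : ~ P' `<=` N.
      by move=> P'N; apply: PQ'; exact: (sub_maximal_comparable hic hR mN nP'.1 nQ'.1).
    by split; [exact: uP|exact: uQ].
  move=> P' Q' nP' nQ' PQ'; have [P'M|P'N] := sub P' nP'; first by left; exact: H.
  have [Q'M|Q'N] := sub Q' nQ'.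
    by right; apply/and_comm; apply: H => //; apply: contra_not PQ' => /incl_comparable_sym.
  by case: PQ'; exact: (sub_maximal_comparable hic hR mN nP'.1 nQ'.1).
(* Three such maximal ideals rule out that [R] has exactly two, so non-maximal primes are comparable
   and a single one escapes all three. *)
- apply: contrapT => /[dup] n2 /card_le_II_seq[s [us ss sM]].
  have Max2 : ~ (Max R #= `I_2).
    move=> M2; apply: n2; rewrite -(card_le_eqr M2); apply: subset_card_le.
    by move=> L [].
  have mMax L : L \in s -> is_maximal_ideal L by move=> /sM[].
  have := @non_maximal_prime_outside R s (cmp Max2).
  case: s us ss sM mMax => [|M1 [|M2 [|M3 [|? ?]]]] // us _ sM mMax [//||P nP sP].
    move=> L /sM[_ /existsNP[P /not_implyP[nP PL]]]; by exists P.
  apply: (@three_maximal_absurd R hic hR M1 M2 M3) => //; last by exists P.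
  + by apply: mMax; rewrite !in_cons eqxx.
  + by apply: mMax; rewrite !in_cons eqxx ?orbT.
  + by apply: mMax; rewrite !in_cons eqxx ?orbT.
Qed.
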